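(* Let $f_1,\dots,f_m:\mathbb{R}^n\to\mathbb{R}$ be convex functions and let $X_1,\dots,X_m\subseteq\mathbb{R}^n$ be closed convex sets that are all the same, $X_i=X$ for a closed convex set $X$. Assume there is a scalar $L>0$ such that for all $i$, $\|d\|\le L$ for all $d\in\partial f_i(x)$ and all $x\in X$. Suppose the weights $a^i_j(k)$ satisfy the Weights Rule, Doubly Stochasticity, Connectivity and Bounded Intercommunication Interval assumptions (stated in the context). Let $\{x^i(k)\}$, $i=1,\dots,m$, be the iterates generated by the projected subgradient algorithm $$v^i(k)=\sum_{j=1}^m a^i_j(k)x^j(k),\qquad x^i(k+1)=P_{X_i}\big[v^i(k)-\alpha_k d_i(k)\big],\qquad k\ge0,$$ with $x^i(0)\in X_i$, $d_i(k)\in\partial f_i(v^i(k))$, and stepsizes $\alpha_k>0$ satisfying $\sum_k\alpha_k=\infty$ and $\sum_k\alpha_k^2<\infty$. In addition, assume that the optimal solution set $X^*$ of the problem of minimizing $\sum_{i=1}^m f_i(x)$ subject to $x\in\bigcap_{i=1}^m X_i$ is nonempty. Then there exists an optimal point $x^*\in X^*$ such that $$\lim_{k\to\infty}\|x^i(k)-x^*\|=0\qquad\text{for all } i\in\{1,\dots,m\}.$$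
   Context: $\|\cdot\|$ is the Euclidean norm and $P_C[z]$ is the Euclidean projection of $z$ on a closed convex set $C$. For a convex function $F:\mathbb{R}^n\to\mathbb{R}$, $\partial F(\bar x)$ is the set of subgradients of $F$ at $\bar x$, i.e. vectors $s$ with $F(\bar x)+s'(x-\bar x)\le F(x)$ for all $x\in\mathbb{R}^n$. The weights are real numbers $a^i_j(k)$, $i,j\in\{1,\dots,m\}$, $k\ge0$, with $a^i(k)=(a^i_1(k),\dots,a^i_m(k))'$. Assumptions: Weights Rule: there is a scalar $\eta$ with $0<\eta<1$ such that for all $i$: (a) $a^i_i(k)\ge\eta$ for all $k\ge0$; (b) if $a^i_j(k)>0$ then $a^i_j(k)\ge\eta$. Doubly Stochasticity: (a) $a^i(k)\ge0$ and $\sum_{j=1}^m a^i_j(k)=1$ for all $i,k$; (b) $\sum_{i=1}^m a^i_j(k)=1$ for all $j,k$. Connectivity: let $V=\{1,\dots,m\}$, $E_k=\{(j,i)\mid a^i_j(k)>0\}$, and $E_\infty=\{(j,i)\mid (j,i)\in E_k \text{ for infinitely many } k\}$. The directed graph $(V,E_\infty)$ is strongly connected. Bounded Intercommunication Interval: there is an integer $B\ge1$ such that for every $(j,i)\in E_\infty$ and every $k\ge0$, $(j,i)\in E_k\cup E_{k+1}\cup\dots\cup E_{k+B-1}$. *)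

(* Defs.v *)
(* The real line is an arbitrary R : realType, and R^n is the row space. *)
From HB Require Import structures.
From mathcomp Require Import all_boot all_order all_algebra.
From mathcomp Require Import all_classical all_reals all_analysis.

Set Implicit Arguments.
Unset Strict Implicit.
Unset Printing Implicit Defensive.

Import Order.TTheory GRing.Theory Num.Theory.
Import numFieldNormedType.Exports.

Local Open Scope classical_set_scope.
Local Open Scope ring_scope.

Section Euclidean.
Context {R : realType} {n : nat}.
Implicit Types (u v s x y z p : 'rV[R]_n) (C : set 'rV[R]_n).

Definition dotv u v : R := \sum_(l < n) u 0 l * v 0 l.

(* The library norm on 'rV[R]_n is the sup norm, hence this definition; the
   topology (and so [closed]) is the same for both norms. *)
Definition enorm u : R := Num.sqrt (dotv u u).

Definition is_nearest C z p :=
  C p /\ forall y, C y -> enorm (z - p) <= enorm (z - y).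

(* When C is nonempty, closed and convex the nearest point exists and is
   unique; the default value 0 is only used when there is no nearest point. *)
Definition eproj C z : 'rV[R]_n := xget 0 (is_nearest C z).

Definition subgrad (F : 'rV[R]_n -> R) x : set 'rV[R]_n :=
  [set s | forall y, F x + dotv s (y - x) <= F y].

Definition argmin_on (F : 'rV[R]_n -> R) C : set 'rV[R]_n :=
  [set x | C x /\ forall y, C y -> F x <= F y].

End Euclidean.

(* Throughout, [a i j k] is the weight $a^i_j(k)$. *)
Section Weights.
Context {R : realType} {m : nat}.
Variable a : 'I_m -> 'I_m -> nat -> R.

Definition weights_rule :=
  exists2 eta : R, 0 < eta < 1 &
    (forall i k, eta <= a i i k) /\
    (forall i j k, 0 < a i j k -> eta <= a i j k).

Definition doubly_stochastic :=
  [/\ forall i j k, 0 <= a i j k,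
      forall i k, \sum_(j < m) a i j k = 1 &
      forall j k, \sum_(i < m) a i j k = 1].

(* The pair (j, i) is an edge when i puts a positive weight on j. *)
Definition edges (k : nat) : set ('I_m * 'I_m) :=
  [set e | 0 < a e.2 e.1 k].

Definition edges_inf : set ('I_m * 'I_m) :=
  [set e | infinite_set [set k | edges k e]].

Definition strongly_connected (E : set ('I_m * 'I_m)) :=
  forall u v : 'I_m, connect (fun p q => `[< E (p, q) >]) u v.

Definition connectivity := strongly_connected edges_inf.

Definition bounded_intercommunication :=
  exists2 B : nat, (1 <= B)%N &
    forall e, edges_inf e -> forall k,
      (\bigcup_(l in [set l | (l < B)%N]) edges (k + l)) e.

End Weights.

(* [x i k], [v i k], [d i k] are $x^i(k)$, $v^i(k)$, $d_i(k)$. *)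
Definition projected_subgradient {R : realType} {n m : nat}
    (f : 'I_m -> 'rV[R]_n -> R) (Xs : 'I_m -> set 'rV[R]_n)
    (a : 'I_m -> 'I_m -> nat -> R) (alpha : nat -> R)
    (x v d : 'I_m -> nat -> 'rV[R]_n) :=
  [/\ forall i, Xs i (x i 0%N),
      forall i k, v i k = \sum_(j < m) a i j k *: x j k,
      forall i k, subgrad (f i) (v i k) (d i k) &
      forall i k, x i k.+1 = eproj (Xs i) (v i k - alpha k *: d i k)].

(* Main.v *)
(* With the total squared distance [D z k] of the agents to [z] in [X] and the
   disagreement [gap k] of the agents with their mean, one step of the method
   gives
     D z (k+1) <= D z k + b k - 2 alpha_k (F (mean k) - F z),
     b k = m L^2 alpha_k^2 + 2 L alpha_k gap k.
   Over a window of fixed length the transition matrices are doubly stochastic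
   with entries bounded below, so the disagreement contracts up to a sum of
   finitely many stepsizes; it is therefore square summable, like the stepsizes,
   and [b] is summable.  Since the stepsizes are not summable, [F (mean k)]
   comes arbitrarily close to the minimum infinitely often, the (bounded) means
   have an optimal cluster point [p], and quasi-monotonicity of [D p] upgrades this to
   convergence. *)
Require Import Defs.
From HB Require Import structures.
From mathcomp Require Import all_boot all_order all_algebra.
From mathcomp Require Import ring lra.
From mathcomp Require Import all_classical all_reals all_analysis.

Set Implicit Arguments.
Unset Strict Implicit.
Unset Printing Implicit Defensive.

Import Order.TTheory GRing.Theory Num.Theory.
Import numFieldNormedType.Exports.

Local Open Scope classical_set_scope.
Local Open Scope ring_scope.


(** * Euclidean norm on row vectors *)

Section EuclideanNorm.
Context {R : realType} {n : nat}.
Implicit Types (u v w x y z p : 'rV[R]_n) (C X : set 'rV[R]_n) (c e M t : R).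

Lemma dotvC u v : dotv u v = dotv v u.
Proof. by apply: eq_bigr => l _; rewrite mulrC. Qed.

Lemma dotvDl u v w : dotv (u + v) w = dotv u w + dotv v w.
Proof. by rewrite -big_split; apply: eq_bigr => l _; rewrite /= mxE mulrDl. Qed.

Lemma dotvZl c u v : dotv (c *: u) v = c * dotv u v.
Proof. by rewrite mulr_sumr; apply: eq_bigr => l _; rewrite mxE mulrA. Qed.

Lemma dotvDr u v w : dotv w (u + v) = dotv w u + dotv w v.
Proof. by rewrite dotvC dotvDl !(dotvC w). Qed.

Lemma dotvZr c u v : dotv v (c *: u) = c * dotv v u.
Proof. by rewrite dotvC dotvZl dotvC. Qed.

Lemma dotvNl u v : dotv (- u) v = - dotv u v.
Proof. by rewrite -scaleN1r dotvZl mulN1r. Qed.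

Lemma dotvNr u v : dotv v (- u) = - dotv v u.
Proof. by rewrite dotvC dotvNl dotvC. Qed.

Lemma dotv0l u : dotv 0 u = 0.
Proof. by rewrite -(scale0r 0) dotvZl mul0r. Qed.

Lemma dotv_suml (I : Type) (r : seq I) (P : pred I) (F : I -> 'rV[R]_n) v :
  dotv (\sum_(i <- r | P i) F i) v = \sum_(i <- r | P i) dotv (F i) v.
Proof. exact: (big_morph (dotv^~ v) (fun a b => dotvDl a b v) (dotv0l v)). Qed.

Definition dotvE := (dotvDl, dotvDr, dotvNl, dotvNr, dotvZl, dotvZr).

Lemma dotv_ge0 u : 0 <= dotv u u.
Proof. by apply: sumr_ge0 => l _; rewrite -expr2 sqr_ge0. Qed.

Lemma enorm_ge0 u : 0 <= enorm u. Proof. exact: sqrtr_ge0. Qed.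

Lemma enorm_sqr u : enorm u ^+ 2 = dotv u u.
Proof. by rewrite sqr_sqrtr// dotv_ge0. Qed.

Lemma dotv_eq0 u : dotv u u = 0 -> u = 0.
Proof.
move=> u0; apply/rowP => l; rewrite mxE.
have /(_ l) := psumr_eq0P (fun l _ => sqr_ge0 (u 0 l)) u0.
by move=> /(_ isT)/eqP; rewrite sqrf_eq0 => /eqP.
Qed.

Lemma enorm_le u c : 0 <= c -> dotv u u <= c ^+ 2 -> enorm u <= c.
Proof. by move=> c0; rewrite -enorm_sqr ler_sqr ?nnegrE ?enorm_ge0. Qed.

Lemma enorm_lt u c : 0 <= c -> dotv u u < c ^+ 2 -> enorm u < c.
Proof. by move=> c0; rewrite -enorm_sqr ltr_sqr ?nnegrE ?enorm_ge0. Qed.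

Lemma enormZ c u : enorm (c *: u) = `|c| * enorm u.
Proof. by rewrite /enorm !dotvE mulrA -expr2 sqrtrM ?sqr_ge0// sqrtr_sqr. Qed.

Lemma enorm0 : enorm (0 : 'rV[R]_n) = 0.
Proof. by rewrite /enorm dotv0l sqrtr0. Qed.

Lemma enormN u : enorm (- u) = enorm u.
Proof. by rewrite /enorm !dotvE opprK. Qed.

Lemma enorm_distrC u v : enorm (u - v) = enorm (v - u).
Proof. by rewrite -enormN opprB. Qed.

Lemma dotv_le_enorm u v : dotv u v <= enorm u * enorm v.
Proof.
have [/eqP v0|v0] := boolP (enorm v == 0).
  have -> : v = 0 by apply: dotv_eq0; rewrite -enorm_sqr v0 expr0n.
  by rewrite dotvC dotv0l mulr_ge0 ?enorm_ge0.
have vgt0 : 0 < enorm v by rewrite lt_neqAle eq_sym v0 enorm_ge0.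
(* This vector is [enorm v ^+ 2] times the component of [u] orthogonal to [v]; its squared length is
   [enorm v ^+ 2] times the defect in Cauchy-Schwarz. *)
have := dotv_ge0 (enorm v ^+ 2 *: u - dotv u v *: v).
rewrite !dotvE (dotvC v u) -!enorm_sqr.
move: (dotv u v) (enorm u) (enorm_ge0 u) => s r r0 H.
have {H} : 0 <= enorm v ^+ 2 * ((r * enorm v) ^+ 2 - s ^+ 2).
  by apply: le_trans H _; rewrite le_eqVlt; apply/orP; left; apply/eqP; ring.
rewrite pmulr_rge0 ?exprn_gt0// subr_ge0 => H.
have [s0|/ltW s0] := leP s 0; first by rewrite (le_trans s0)// mulr_ge0// ltW.
by rewrite -ler_sqr ?nnegrE ?mulr_ge0// ltW.
Qed.

Lemma enormD u v : enorm (u + v) <= enorm u + enorm v.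
Proof.
apply: enorm_le; first by rewrite addr_ge0 ?enorm_ge0.
rewrite !dotvE (dotvC v u) -!enorm_sqr; have := dotv_le_enorm u v; nra.
Qed.

Lemma enorm_sum (I : Type) (r : seq I) (P : pred I) (F : I -> 'rV[R]_n) :
  enorm (\sum_(i <- r | P i) F i) <= \sum_(i <- r | P i) enorm (F i).
Proof.
apply: (big_ind2 (fun u c => enorm u <= c)) => [|u c v e uc ve|//].
  by rewrite enorm0.
by rewrite (le_trans (enormD _ _))// lerD.
Qed.

Lemma dotvD_le u v : dotv (u + v) (u + v) <= 2 * dotv u u + 2 * dotv v v.
Proof.
have := dotv_ge0 (u - v); rewrite !dotvE (dotvC v u); lra.
Qed.

(** Jensen for the squared norm: the weighted variance of the [F j] about their mean [u] is
    nonnegative. *)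
Lemma dotv_convex_sum (m : nat) (w : 'I_m -> R) (F : 'I_m -> 'rV[R]_n) :
  (forall j, 0 <= w j) -> \sum_j w j = 1 ->
  dotv (\sum_j w j *: F j) (\sum_j w j *: F j) <= \sum_j w j * dotv (F j) (F j).
Proof.
move=> w0 w1; set u := \sum_j _.
have : 0 <= \sum_j w j * dotv (F j - u) (F j - u).
  by apply: sumr_ge0 => j _; rewrite mulr_ge0 ?dotv_ge0.
rewrite (eq_bigr (fun j => w j * dotv (F j) (F j) +
    (w j * dotv u u + - 2 * dotv (w j *: F j) u))) => [|j _]; last first.
  by rewrite !dotvE (dotvC u); ring.
rewrite !big_split/= -mulr_suml -mulr_sumr -dotv_suml w1 -/u; lra.
Qed.

Lemma dotv_convex_dist (m : nat) (w : 'I_m -> R) (F : 'I_m -> 'rV[R]_n) z :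
  (forall j, 0 <= w j) -> \sum_j w j = 1 ->
  dotv (\sum_j w j *: F j - z) (\sum_j w j *: F j - z) <=
    \sum_j w j * dotv (F j - z) (F j - z).
Proof.
move=> w0 w1; have -> : \sum_j w j *: F j - z = \sum_j w j *: (F j - z).
  rewrite -[z in LHS]scale1r -w1 scaler_suml -sumrB.
  by apply: eq_bigr => j _; rewrite scalerBr.
exact: dotv_convex_sum.
Qed.

(** Bolzano-Weierstrass: the sequence stays in the intersection of a box with the closed set [X],
    which is compact. *)
Lemma bounded_seq_cluster X (u : nat -> 'rV[R]_n) M :
  closed X -> (forall k, X (u k)) -> (forall k, enorm (u k) <= M) ->
  exists2 p, X p &
    forall e, 0 < e -> forall N, exists2 k, (N <= k)%N & enorm (u k - p) < e.
Proof.
move=> Xcl uX uM.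
have ub k i : -M <= u k 0 i <= M.
  rewrite -ler_norml; apply: le_trans (uM k).
  rewrite -ler_sqr ?nnegrE ?enorm_ge0// enorm_sqr real_normK ?num_real//.
  rewrite /dotv (bigD1 i)//= -expr2 lerDl.
  by apply: sumr_ge0 => j _; rewrite -expr2 sqr_ge0.
have cub := @rV_compact R n _ (fun _ : 'I_n => @segment_compact R (-M) M).
have [|p [[_ Xp] clp]] :=
    compact_closedI cub Xcl (fmap_proper_filter u eventually_filter).
  exists 0%N => // k _; split => //.
  by move=> i; rewrite /= in_itv/=; exact: ub.
exists p => // e e0 N.
(* Balls here are those of the sup norm. This radius keeps the squared Euclidean norm below
   [n * (e / n.+1) ^+ 2], hence below [e ^+ 2]; the successor covers [n = 0]. *)
have d0 : 0 < e / n.+1%:R by rewrite divr_gt0.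
have [|_ [[k /= Nk <-] [_ bk]]] :=
    clp (u @` [set k | (N <= k)%N]) _ _ (nbhsx_ballx p _ d0).
  by exists N => // k /= Nk; exists k.
exists k => //; apply: enorm_lt; first exact: ltW.
apply: (@le_lt_trans _ _ (\sum_(l < n) (e / n.+1%:R) ^+ 2)).
  apply: ler_sum => l _; have := bk 0 l; rewrite /ball/= => h.
  by rewrite !mxE -expr2 -real_normK ?num_real// ler_sqr ?nnegrE ?(ltW d0)//
    distrC ltW.
rewrite sumr_const card_ord -[_ *+ n]mulr_natl expr_div_n mulrCA
  gtr_pMr ?exprn_gt0//.
rewrite ltr_pdivrMr ?exprn_gt0// mul1r -natrX ltr_nat.
by rewrite expnS expn1 mulSn ltn_addr.
Qed.

End EuclideanNorm.

(** * Projections and subgradients *)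

Section ConvexSets.
Context {R : realType} {n : nat}.
Implicit Types (u v w x y z p : 'rV[R]_n) (X : set 'rV[R]_n) (c e t : R).

Lemma convex_set_mem X y z t : convex_set X -> X y -> X z -> 0 <= t <= 1 ->
  X (t *: y + (1 - t) *: z).
Proof.
move=> Xc Xy Xz /andP[t0 t1].
by have := Xc y z (Itv01 t0 t1) (mem_set Xy) (mem_set Xz); rewrite inE.
Qed.

(* Scaling by the total weight turns closure of [X] under binary convex
   combinations into closure of the cone [{(t, t *: u) | u in X}] under sums. *)
Lemma convex_set_sum X (m : nat) (w : 'I_m -> R) (u : 'I_m -> 'rV[R]_n) :
  convex_set X -> (forall j, 0 <= w j) -> \sum_j w j = 1 ->
  (forall j, X (u j)) -> X (\sum_j w j *: u j).
Proof.
move=> Xc w0 w1 Xu.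
have [z Xz] : X !=set0.
  case: m w u w0 w1 Xu => [w u _|m w u _ _ Xu]; last by exists (u ord0).
  by rewrite big_ord0 => /esym/eqP; rewrite oner_eq0.
suff [_ [p Xp ->]] : 0 <= \sum_j w j /\
    exists2 p, X p & \sum_j w j *: u j = (\sum_j w j) *: p.
  by rewrite w1 scale1r.
apply: (big_ind2 (fun (t : R) q => 0 <= t /\ exists2 p, X p & q = t *: p)).
- by split => //; exists z; rewrite ?scale0r.
- move=> t p s q [t0 [p' Xp' ->]] [s0 [q' Xq' ->]]; split.
    exact: addr_ge0.
  have [ts|ts] := eqVneq (t + s) 0.
    have t0' : t = 0 by lra.
    have s0' : s = 0 by lra.
    by exists z; rewrite ?t0' ?s0' ?addr0 ?scale0r ?addr0.
  exists (t / (t + s) *: p' + (1 - t / (t + s)) *: q').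
    apply: convex_set_mem => //.
    have tsp : 0 < t + s by rewrite lt_def ts addr_ge0.
    by rewrite divr_ge0 ?addr_ge0// ler_pdivrMr// mul1r lerDl.
  by rewrite scalerDr !scalerA; congr (_ *: _ + _ *: _); field.
- by move=> j _; split => //; exists (u j).
Qed.

(** A minimizing sequence of the distance is bounded, and its cluster points in [X] attain the
    infimum. *)
Lemma nearest_exists X z : closed X -> X !=set0 -> exists p, is_nearest X z p.
Proof.
move=> Xcl [y0 Xy0]; pose E := [set enorm (z - y) | y in X].
have Elb : lbound E 0 by move=> _ [y _ <-]; exact: enorm_ge0.
have Einf : has_inf E by split; [exists (enorm (z - y0)), y0 | exists 0].
have Ele y : X y -> inf E <= enorm (z - y).
  by move=> Xy; apply: ge_inf; [exists 0|exists y].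
have near k : exists y, X y /\ enorm (z - y) < inf E + k.+1%:R^-1.
  have [|_ [y Xy <-] ylt] := @inf_adherent _ E k.+1%:R^-1 _ Einf.
    by rewrite invr_gt0.
  by exists y.
have [u Hu] := choice near.
have ub k : enorm (u k) <= enorm z + inf E + 1.
  have -> : u k = z + - (z - u k) by rewrite opprB addrC subrK.
  rewrite (le_trans (enormD _ _))// enormN -addrA lerD2l.
  rewrite (le_trans (ltW (Hu k).2))// lerD2l invf_le1 ?ler1n//.
have [p Xp clp] := bounded_seq_cluster Xcl (fun k => (Hu k).1) ub.
exists p; split => // y /Ele; apply: le_trans; apply/ler_addgt0Pr => e e0.
have e20 : 0 < e / 2 by rewrite divr_gt0.
have [N _ HN] := near_infty_natSinv_lt (PosNum e20).
have [k Nk kp] := clp _ e20 N.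
have kN : k.+1%:R^-1 < e / 2 := HN k Nk.
have -> : z - p = (z - u k) + (u k - p) by rewrite addrA subrK.
have := enormD (z - u k) (u k - p); have := (Hu k).2.
move: kN; move: (k.+1%:R^-1) => r; lra.
Qed.

Lemma nearest_dotv_le0 X z p y :
  convex_set X -> is_nearest X z p -> X y -> dotv (z - p) (y - p) <= 0.
Proof.
move=> Xc [Xp pmin] Xy; rewrite leNgt; apply/negP => d0.
have y0 : 0 <= dotv (y - p) (y - p) := dotv_ge0 _.
set d := dotv (z - p) _ in d0; set b := dotv (y - p) _ in y0.
(* With this [t] one has [t * b = d - t * d], so moving from [p] towards [y] by [t] lowers the
   squared distance to [z] by [t * d + t ^+ 2 * d > 0]. *)
pose t := d / (d + b).
have db : 0 < d + b by lra.
have t01 : 0 < t <= 1.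
  by rewrite divr_gt0//= ler_pdivrMr// mul1r lerDl.
have Xq : X (t *: y + (1 - t) *: p).
  by apply: convex_set_mem => //; case/andP: t01 => /ltW -> ->.
have := pmin _ Xq.
rewrite -ler_sqr ?nnegrE ?enorm_ge0// !enorm_sqr.
have -> : z - (t *: y + (1 - t) *: p) = (z - p) - t *: (y - p).
  by apply/rowP => l; rewrite !mxE; ring.
have -> q r : dotv (q - t *: r) (q - t *: r) =
    dotv q q - 2 * t * dotv q r + t * (t * dotv r r).
  by rewrite !dotvE (dotvC r q); ring.
rewrite -/d -/b.
have -> : t * b = d - t * d by rewrite /t; field; rewrite gt_eqF.
by have [t0 _] := andP t01; have := mulr_gt0 t0 d0; have := mulr_gt0 t0 t0; nra.
Qed.

Section Projection.
Variables (X : set 'rV[R]_n) (z : 'rV[R]_n).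
Hypotheses (Xcl : closed X) (X0 : X !=set0).

Lemma eproj_nearest : is_nearest X z (eproj X z).
Proof. exact: (xgetPex 0 (nearest_exists z Xcl X0)). Qed.

Lemma eproj_mem : X (eproj X z). Proof. by case: eproj_nearest. Qed.

(** Expand [z - y] as [(z - p) - (y - p)] with [p] the projection: the cross term has the right sign
    because the angle at [p] is not acute. *)
Lemma eproj_dist_le y : convex_set X -> X y ->
  dotv (eproj X z - y) (eproj X z - y) <= dotv (z - y) (z - y).
Proof.
move=> Xc Xy; have := nearest_dotv_le0 Xc eproj_nearest Xy.
have := dotv_ge0 (z - eproj X z); move: (eproj X z) => p.
have -> : z - y = (z - p) - (y - p) by apply/rowP => l; rewrite !mxE; ring.
have -> : p - y = - (y - p) by rewrite opprB.
move: (z - p) (y - p) => q r; rewrite !dotvE (dotvC r q); lra.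
Qed.

(** Triangle inequality through [z]. With [y] the mixed point, it bounds the displacement of an
    agent by twice its subgradient step. *)
Lemma eproj_move_le y : X y -> enorm (eproj X z - y) <= 2 * enorm (z - y).
Proof.
move=> Xy; have := eproj_nearest.2 _ Xy.
have -> : eproj X z - y = (z - y) - (z - eproj X z).
  by apply/rowP => l; rewrite !mxE; ring.
by have := enormD (z - y) (- (z - eproj X z)); rewrite enormN; lra.
Qed.

End Projection.
End ConvexSets.

(** * Existence of subgradients and the resulting Lipschitz bound *)

Section Subgradients.
Context {R : realType} {n : nat}.
Implicit Types (F g : 'rV[R]_n -> R) (s y z h : 'rV[R]_n).

Lemma convex_function_le F y z (t : R) :
  convex_function setT F -> 0 <= t <= 1 ->
  F (t *: y + (1 - t) *: z) <= t * F y + (1 - t) * F z.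
Proof.
by move=> Fc /andP[t0 t1]; apply: (Fc (Itv01 t0 t1) y z); rewrite inE.
Qed.

(* Hahn-Banach, one coordinate at a time: the admissible slopes in direction
   [e] lie between a supremum of left and an infimum of right difference
   quotients, and these are ordered by convexity. *)
Lemma convex_supporting_slope g (H : set 'rV[R]_n) s e :
  (forall y z (t : R), 0 <= t <= 1 ->
     g (t *: y + (1 - t) *: z) <= t * g y + (1 - t) * g z) ->
  H 0 -> (forall y z (t : R), H y -> H z -> H (t *: y + (1 - t) *: z)) ->
  (forall h, H h -> dotv s h <= g h) ->
  exists c : R, forall h t, H h -> dotv s h + t * c <= g (h + t *: e).
Proof.
move=> gc H0 Hc Hs.
pose A := [set r | exists h t, [/\ H h, 0 < t &
  r = (dotv s h - g (h - t *: e)) / t]].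
have Aub h t : H h -> 0 < t -> ubound A ((g (h + t *: e) - dotv s h) / t).
  move=> Hh t0 _ [k [r [Hk r0 ->]]].
  rewrite ler_pdivrMr// mulrAC ler_pdivlMr//.
  have rt0 : 0 < r + t by rewrite addr_gt0.
  (* This weight cancels the multiples of [e] in the convex combination of [k - r *: e] and
     [h + t *: e]. *)
  pose l := t / (r + t).
  have l01 : 0 <= l <= 1.
    rewrite divr_ge0 ?(ltW t0) ?(ltW rt0)//= /l.
    by rewrite ler_pdivrMr// mul1r lerDr ltW.
  have := le_trans (Hs _ (Hc k h l Hk Hh)).
  have {1}-> : l *: k + (1 - l) *: h =
      l *: (k - r *: e) + (1 - l) *: (h + t *: e).
    by apply/rowP => i; rewrite !mxE /l; field; rewrite gt_eqF.
  move=> /(_ _ (gc _ _ _ l01)); rewrite !dotvE.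
  move: (dotv s k) (dotv s h) (g (k - _)) (g (h + _)) => a b ga gb.
  rewrite -(ler_pM2r rt0) /l => le.
  have E1 : (t / (r + t) * a + (1 - t / (r + t)) * b) * (r + t) = t * a + r * b.
    by field; rewrite gt_eqF.
  have E2 : (t / (r + t) * ga + (1 - t / (r + t)) * gb) * (r + t) =
      t * ga + r * gb.
    by field; rewrite gt_eqF.
  by move: le; rewrite E1 E2; lra.
have A0 : A !=set0.
  by exists ((dotv s 0 - g (0 - 1 *: e)) / 1), 0, 1; split.
have Asup : has_ubound A.
  by exists ((g (0 + 1 *: e) - dotv s 0) / 1); exact: Aub.
exists (sup A) => h t Hh; have [t0|t0|->] := ltgtP t 0.
- have : (dotv s h - g (h + t *: e)) / - t <= sup A.
    apply: ub_le_sup => //; exists h, (- t).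
    split => //; first by rewrite oppr_gt0.
    by rewrite scaleNr opprK.
  by rewrite ler_pdivrMr ?oppr_gt0//; lra.
- by have := ge_sup A0 (Aub h t Hh t0); rewrite ler_pdivlMr//; lra.
- by rewrite mul0r scale0r !addr0; exact: Hs.
Qed.

(** A linear minorant of the increment [g] is extended from the span [H k] of the first [k]
    coordinate vectors to the next one; on [H n], the whole space, it is a subgradient. *)
Lemma subgrad_nonempty F y : convex_function setT F -> subgrad F y !=set0.
Proof.
move=> Fc; pose g h := F (y + h) - F y.
have gc u v (t : R) : 0 <= t <= 1 ->
    g (t *: u + (1 - t) *: v) <= t * g u + (1 - t) * g v.
  move=> t01; have := convex_function_le (y + u) (y + v) Fc t01.
  have -> : t *: (y + u) + (1 - t) *: (y + v) = y + (t *: u + (1 - t) *: v).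
    by apply/rowP => l; rewrite !mxE; ring.
  rewrite /g; lra.
pose H k : set 'rV[R]_n := [set h | forall l : 'I_n, (k <= l)%N -> h 0 l = 0].
suff /(_ n)[s sP] : forall k, exists s, forall h, H k h -> dotv s h <= g h.
  exists s => z /=; have := sP (z - y); rewrite /g.
  rewrite [y + _]addrC subrK lerBrDr [_ + F y]addrC.
  by apply => l; rewrite leqNgt ltn_ord.
elim=> [|k [s sP]].
  exists 0 => h h0; have -> : h = 0 by apply/rowP => l; rewrite mxE; exact: h0.
  by rewrite dotv0l /g addr0 subrr.
have [nk|kn] := leqP n k.
  by exists s => h _; apply: sP => l /(leq_trans nk); rewrite leqNgt ltn_ord.
pose ko := Ordinal kn; pose e : 'rV[R]_n := delta_mx 0 ko.
have [|u v t Hu Hv l kl|//|c cP] :=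
    convex_supporting_slope (H := H k) (s := s) e gc.
- by move=> l _; rewrite mxE.
- by rewrite !mxE Hu// Hv// !mulr0 addr0.
(* Coordinate [ko] of [s] is replaced by the slope [c]. *)
exists (s + (c - s 0 ko) *: e) => h Hh.
have de v : dotv v e = v 0 ko.
  rewrite /dotv (bigD1 ko)//= big1 => [|l lk]; last first.
    by rewrite mxE eqxx (negPf lk) mulr0.
  by rewrite mxE !eqxx mulr1 addr0.
have := cP (h - h 0 ko *: e) (h 0 ko).
rewrite subrK !dotvE !de (dotvC e) de => H1.
apply: le_trans (H1 _); first lra.
move=> l; rewrite leq_eqVlt => /orP[/eqP kl|kl].
  have -> : l = ko by apply: val_inj.
  by rewrite !mxE !eqxx mulr1 subrr.
have lk : l != ko by rewrite neq_ltn kl orbT.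
by rewrite !mxE (Hh l)// (negPf lk) andbF mulr0 subr0.
Qed.

(** Some subgradient exists at [y], and it bounds the drop of [F] from [y] to [z]; so the bound on
    subgradients is a Lipschitz constant. *)
Lemma subgrad_bounded_lipschitz F (X : set 'rV[R]_n) (L : R) y z :
  convex_function setT F ->
  (forall y s, X y -> subgrad F y s -> enorm s <= L) ->
  X y -> F y - F z <= L * enorm (y - z).
Proof.
move=> Fc FL Xy; have [s sP] := subgrad_nonempty y Fc.
have := FL _ _ Xy sP; have := sP z; have := dotv_le_enorm s (y - z).
have := enorm_ge0 (y - z); rewrite -[z - y]opprB dotvNr.
move: (enorm _) (enorm _) (dotv _ _) => a b c a0 cba Fc' bL.
have := ler_wpM2r a0 bL; lra.
Qed.

End Subgradients.

(** * Square summability and disagreement *)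

Section BoundedSums.
Context {R : realType}.
Implicit Types (u v : nat -> R) (c q e : R).

(** For nonnegative terms this is summability, phrased without limits. *)
Definition bounded_sums u := exists C, forall N, \sum_(k < N) u k <= C.

Lemma bounded_sums_le u v : (forall k, u k <= v k) ->
  bounded_sums v -> bounded_sums u.
Proof.
by move=> uv [C HC]; exists C => N; rewrite (le_trans _ (HC N))// ler_sum.
Qed.

Lemma bounded_sumsD u v : bounded_sums u -> bounded_sums v ->
  bounded_sums (fun k => u k + v k).
Proof.
by move=> [C HC] [D HD]; exists (C + D) => N; rewrite big_split lerD.
Qed.

Lemma bounded_sumsZ c u : 0 <= c -> bounded_sums u ->
  bounded_sums (fun k => c * u k).
Proof.
by move=> c0 [C HC]; exists (c * C) => N; rewrite -mulr_sumr ler_wpM2l.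
Qed.

Lemma sum_ordD u (M N : nat) :
  \sum_(k < M + N) u k = \sum_(k < M) u k + \sum_(k < N) u (M + k)%N.
Proof. by rewrite big_split_ord. Qed.

Lemma bounded_sums_shift u (M : nat) : (forall k, 0 <= u k) ->
  bounded_sums u -> bounded_sums (fun k => u (k + M)%N).
Proof.
move=> u0 [C HC]; exists C => N; apply: le_trans (HC (M + N)%N).
rewrite sum_ordD (eq_bigr (fun k : 'I_N => u (M + k)%N)) => [|k _].
  by rewrite lerDr sumr_ge0.
by rewrite addnC.
Qed.

Lemma bounded_sums_sqrD u v :
  bounded_sums (fun k => u k ^+ 2) -> bounded_sums (fun k => v k ^+ 2) ->
  bounded_sums (fun k => (u k + v k) ^+ 2).
Proof.
move=> bu bv; have b := bounded_sumsZ (ler0n R 2) (bounded_sumsD bu bv).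
by apply: bounded_sums_le b => k; have := sqr_ge0 (u k - v k); lra.
Qed.

(** From some [N] on, the partial sums lie within [e] of their supremum. *)
Lemma bounded_sums_tail u : (forall k, 0 <= u k) -> bounded_sums u ->
  forall e, 0 < e -> exists N : nat, forall k M, (N <= k)%N ->
    \sum_(t < M) u (k + t)%N <= e.
Proof.
move=> u0 [C HC] e e0; pose E := range (fun N => \sum_(k < N) u k).
have Esup : has_sup E.
  by split; [exists (\sum_(k < 0) u k), 0%N | exists C => _ [N _ <-]].
have [_ [N _ <-] lt] := sup_adherent e0 Esup; exists N => k M /subnKC Nk.
have := ub_le_sup Esup.2 (ex_intro2 _ _ (k + M)%N I erefl).
rewrite sum_ordD -[in X in X + _]Nk sum_ordD.
suff : 0 <= \sum_(t < k - N) u (N + t)%N by lra.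
by rewrite sumr_ge0.
Qed.

(** After squaring, the sum of the first [N] squares is at most the first [T] of them plus [q] times
    itself plus a constant; the multiple by [q < 1] is absorbed on the left. *)
Lemma bounded_sums_sqr_recursion u v (T : nat) q :
  (forall k, 0 <= u k) -> 0 <= q < 1 ->
  (forall k, u (k + T)%N <= q * u k + v k) ->
  bounded_sums (fun k => v k ^+ 2) -> bounded_sums (fun k => u k ^+ 2).
Proof.
move=> u0 /andP[q0 q1] uT [C HC].
have q'0 : 0 < 1 - q by lra.
exists ((\sum_(k < T) u k ^+ 2 + (1 - q)^-1 * C) / (1 - q)) => N.
rewrite ler_pdivlMr//.
(* Convexity of the square, with [q * u + v] read as the combination of [u] and [v / (1 - q)] with
   weights [q] and [1 - q]. *)
have sq k : u (T + k)%N ^+ 2 <= q * u k ^+ 2 + (1 - q)^-1 * v k ^+ 2.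
  have : 0 <= (1 - q)^-1 * q * ((1 - q) * u k - v k) ^+ 2.
    by rewrite mulr_ge0 ?sqr_ge0// mulr_ge0// invr_ge0 ltW.
  have -> : (1 - q)^-1 * q * ((1 - q) * u k - v k) ^+ 2 =
      q * u k ^+ 2 + (1 - q)^-1 * v k ^+ 2 - (q * u k + v k) ^+ 2.
    by field; rewrite gt_eqF.
  rewrite subr_ge0; apply: le_trans; rewrite addnC ler_sqr ?nnegrE//.
  exact: le_trans (uT k).
have : \sum_(k < N) u k ^+ 2 <= \sum_(k < T + N) u k ^+ 2.
  rewrite addnC (sum_ordD (fun k => u k ^+ 2)) lerDl.
  by rewrite sumr_ge0// => k _; rewrite sqr_ge0.
rewrite (sum_ordD (fun k => u k ^+ 2)).
have := ler_sum (index_enum 'I_N) (fun (k : 'I_N) (_ : true) => sq k).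
have : (1 - q)^-1 * \sum_(k < N) v k ^+ 2 <= (1 - q)^-1 * C.
  by rewrite ler_wpM2l// invr_ge0 ltW.
rewrite big_split/= -!mulr_sumr.
by move: (_^-1 * _) (_^-1 * _) => s t; lra.
Qed.

End BoundedSums.

(** * Disagreement among the rows of a matrix *)

Section Disagreement.
Context {R : realType} {m n : nat}.
Implicit Types (Y Z : 'M[R]_(m, n)) (M W : 'M[R]_m) (c : R).

(** Rows are the agents' vectors. For this norm a nonnegative matrix acts with a factor bounded by
    its column sums. *)
Definition rows_norm Y : R := \sum_i enorm (row i Y).

(** The projection [J] on consensus: every row of [J Y] is the mean of the rows of [Y]. *)
Definition avg_mx : 'M[R]_m := const_mx m%:R^-1.

Definition disagreement Y : R := rows_norm (Y - avg_mx *m Y).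

Definition doubly_stochastic_mx M :=
  [/\ forall i j, 0 <= M i j, forall i, \sum_j M i j = 1
    & forall j, \sum_i M i j = 1].

Lemma rows_norm_ge0 Y : 0 <= rows_norm Y.
Proof. by apply: sumr_ge0 => i _; exact: enorm_ge0. Qed.

Lemma disagreement_ge0 Y : 0 <= disagreement Y.
Proof. exact: rows_norm_ge0. Qed.

Lemma rows_normD Y Z : rows_norm (Y + Z) <= rows_norm Y + rows_norm Z.
Proof.
by rewrite -big_split; apply: ler_sum => i _; rewrite linearD enormD.
Qed.

Lemma rows_normN Y : rows_norm (- Y) = rows_norm Y.
Proof. by apply: eq_bigr => i _; rewrite linearN enormN. Qed.

Lemma rows_norm_mul M Y c : (forall i j, 0 <= M i j) ->
  (forall j, \sum_i M i j <= c) -> rows_norm (M *m Y) <= c * rows_norm Y.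
Proof.
move=> M0 Mc; apply: (@le_trans _ _ (\sum_i \sum_j M i j * enorm (row j Y))).
  apply: ler_sum => i _; rewrite row_mul mulmx_sum_row.
  rewrite (le_trans (enorm_sum _ _ _))//; apply: ler_sum => j _.
  by rewrite mxE enormZ ger0_norm.
rewrite exchange_big/= mulr_sumr; apply: ler_sum => j _.
by rewrite -mulr_suml ler_wpM2r ?enorm_ge0.
Qed.

Lemma doubly_stochastic1 : doubly_stochastic_mx 1%:M.
Proof.
split=> [i j|i|j]; first by rewrite mxE ler0n.
- rewrite (bigD1 i)//= big1 ?mxE ?eqxx ?addr0// => j ji.
  by rewrite mxE eq_sym (negPf ji).
- rewrite (bigD1 j)//= big1 ?mxE ?eqxx ?addr0// => i ij.
  by rewrite mxE (negPf ij).
Qed.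

Lemma doubly_stochasticM M W : doubly_stochastic_mx M ->
  doubly_stochastic_mx W -> doubly_stochastic_mx (M *m W).
Proof.
move=> [M0 Mr Mc] [W0 Wr Wc]; split=> [i j|i|j].
- by rewrite mxE sumr_ge0// => l _; rewrite mulr_ge0.
- rewrite -(Mr i); under eq_bigr do rewrite mxE.
  by rewrite exchange_big; apply: eq_bigr => l _; rewrite -mulr_sumr Wr mulr1.
- rewrite -(Wc j); under eq_bigr do rewrite mxE.
  by rewrite exchange_big; apply: eq_bigr => l _; rewrite -mulr_suml Mc mul1r.
Qed.

Lemma doubly_stochastic_const M c : doubly_stochastic_mx M ->
  M *m const_mx c = const_mx c :> 'M[R]_m.
Proof.
move=> [_ Mr _]; apply/matrixP => i j; rewrite !mxE.
by under eq_bigr do rewrite mxE; rewrite -mulr_suml Mr mul1r.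
Qed.

Lemma const_doubly_stochastic M c : doubly_stochastic_mx M ->
  const_mx c *m M = const_mx c :> 'M[R]_m.
Proof.
move=> [_ _ Mc]; apply/matrixP => i j; rewrite !mxE.
by under eq_bigr do rewrite mxE; rewrite -mulr_sumr Mc mulr1.
Qed.

(** A doubly stochastic [M] commutes with [J], so the deviation of [M Y] is [M] applied to the
    deviation of [Y], and the column sums are 1. *)
Lemma disagreement_mul M Y : doubly_stochastic_mx M ->
  disagreement (M *m Y) <= disagreement Y.
Proof.
move=> Mds; rewrite /disagreement mulmxA const_doubly_stochastic//.
rewrite -{1}(doubly_stochastic_const m%:R^-1 Mds) -mulmxA -mulmxBr.
case: Mds => M0 _ Mc; rewrite -[leRHS]mul1r.
by apply: rows_norm_mul => // j; rewrite Mc.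
Qed.

Lemma disagreementD Y Z :
  disagreement (Y + Z) <= disagreement Y + disagreement Z.
Proof.
rewrite (le_trans _ (rows_normD _ _))//.
by rewrite /disagreement mulmxDr opprD addrACA.
Qed.

Hypothesis m0 : (0 < m)%N.

Lemma avg_mx_ds : doubly_stochastic_mx avg_mx.
Proof.
have h : \sum_(i < m) m%:R^-1 = 1 :> R.
  by rewrite sumr_const card_ord -[LHS]mulr_natl divff// pnatr_eq0 -lt0n.
split=> [i j|i|j]; first by rewrite mxE invr_ge0 ler0n.
- by rewrite -[RHS]h; apply: eq_bigr => j _; rewrite mxE.
- by rewrite -[RHS]h; apply: eq_bigr => i _; rewrite mxE.
Qed.

Lemma disagreement_le Y : disagreement Y <= 2 * rows_norm Y.
Proof.
rewrite (le_trans (rows_normD _ _))// rows_normN.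
suff : rows_norm (avg_mx *m Y) <= 1 * rows_norm Y by lra.
by case: avg_mx_ds => a0 _ ac; apply: rows_norm_mul => // j; rewrite ac.
Qed.

(* [W - J] and [W - d 1 1^T] agree on the deviations [Y - J Y], and the latter
   matrix is nonnegative with column sums [1 - m d]. *)
Lemma disagreement_contract W Y d : doubly_stochastic_mx W ->
  (forall i j, d <= W i j) ->
  disagreement (W *m Y) <= (1 - m%:R * d) * disagreement Y.
Proof.
move=> Wds Wd; have -> : disagreement (W *m Y) =
    rows_norm ((W - const_mx d) *m (Y - avg_mx *m Y)).
  rewrite /disagreement mulmxA const_doubly_stochastic//; congr rows_norm.
  rewrite mulmxBr mulmxBl mulmxBl !mulmxA doubly_stochastic_const//.
  rewrite (const_doubly_stochastic _ avg_mx_ds).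
  by rewrite opprB addrA subrK.
case: Wds => _ _ Wc; apply: rows_norm_mul => [i j|j].
  by rewrite !mxE subr_ge0.
under eq_bigr do rewrite !mxE.
by rewrite big_split/= Wc sumr_const card_ord -[- d *+ m]mulr_natl mulrN.
Qed.

End Disagreement.
Arguments avg_mx {R m}.

(** * Transition matrices *)

Section Consensus.
Context {R : realType} {m : nat}.
Variable a : 'I_m -> 'I_m -> nat -> R.
Hypothesis a_doubly : doubly_stochastic a.

Definition weight_mx (k : nat) : 'M[R]_m := \matrix_(i, j) a i j k.

(** The product of the [l] weight matrices of times [k] to [k + l - 1], latest on the left. *)
Fixpoint transition_mx (k l : nat) : 'M[R]_m :=
  if l is l'.+1 then weight_mx (k + l') *m transition_mx k l' else 1%:M.

Lemma weight_mx_ds k : doubly_stochastic_mx (weight_mx k).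
Proof.
case: a_doubly => a0 ar ac; split=> [i j|i|j]; first by rewrite mxE.
- by rewrite -[RHS](ar i k); apply: eq_bigr => j _; rewrite mxE.
- by rewrite -[RHS](ac j k); apply: eq_bigr => i _; rewrite mxE.
Qed.

Lemma transition_mx_ds k l : doubly_stochastic_mx (transition_mx k l).
Proof.
elim: l => [|l IH]; first exact: doubly_stochastic1.
exact: doubly_stochasticM (weight_mx_ds _) IH.
Qed.

(** Each error is later multiplied only by doubly stochastic matrices, which do not increase its
    disagreement, so the errors just add up. *)
Lemma disagreement_transition (n : nat) (Y E : nat -> 'M[R]_(m, n))
    (c : nat -> R) k l :
  (forall k, Y k.+1 = weight_mx k *m Y k + E k) ->
  (forall k, disagreement (E k) <= c k) ->
  disagreement (Y (k + l)%N - transition_mx k l *m Y k) <=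
    \sum_(t < l) c (k + t)%N.
Proof.
move=> YE Ec; elim: l => [|l IH].
  by rewrite addn0 mul1mx subrr big_ord0 /disagreement mulmx0 subrr
    /rows_norm big1// => i _; rewrite linear0 enorm0.
rewrite big_ord_recr addnS YE /= -mulmxA addrAC -mulmxBr.
rewrite (le_trans (disagreementD _ _))// lerD//.
by rewrite (le_trans (disagreement_mul _ (weight_mx_ds _))).
Qed.

(** * Lower bounds on the entries of transition matrices *)

Section Positivity.
Variable eta : R.
Hypotheses (eta0 : 0 <= eta) (a_diag : forall i k, eta <= a i i k).
Hypothesis a_pos : forall i j k, 0 < a i j k -> eta <= a i j k.

(** The single term through [i] already bounds the entry of the product. *)
Lemma transition_step k l i i' j : eta <= a i' i (k + l) ->
  eta ^+ l <= transition_mx k l i j ->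
  eta ^+ l.+1 <= transition_mx k l.+1 i' j.
Proof.
move=> ai Tj; case: (transition_mx_ds k l) => T0 _ _.
case: a_doubly => a0 _ _; rewrite /= mxE (bigD1 i)//= mxE exprS.
apply: ler_wpDr; last by rewrite ler_pM// exprn_ge0.
by apply: sumr_ge0 => r _; rewrite mxE mulr_ge0.
Qed.

Lemma transition_persist k l l' i j : (l <= l')%N ->
  eta ^+ l <= transition_mx k l i j -> eta ^+ l' <= transition_mx k l' i j.
Proof.
move=> /subnKC <-; elim: (l' - l)%N => [|r IH] Tl; first by rewrite addn0.
by rewrite addnS; apply: transition_step (IH Tl).
Qed.

(** Each edge of the path gets a window of [B] steps: wait on self-loops until the edge occurs,
    cross it, and wait for the end of the window. *)
Lemma transition_path k (B : nat) (u : 'I_m) (p : seq 'I_m) :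
  (forall e, edges_inf a e -> forall k,
     (\bigcup_(l in [set l | (l < B)%N]) edges a (k + l)) e) ->
  path (fun p q => `[< edges_inf a (p, q) >]) u p ->
  eta ^+ (size p * B) <= transition_mx k (size p * B) (last u p) u.
Proof.
move=> aB; elim/last_ind: p => [_|p w IH]; first by rewrite mxE eqxx.
rewrite rcons_path last_rcons size_rcons => /andP[/IH Tp /asboolP pw].
have [l /= lB aw] := aB _ pw (k + size p * B)%N.
have ll : (size p * B <= size p * B + l)%N by exact: leq_addr.
apply: (@transition_persist _ (size p * B + l).+1).
  by rewrite mulSn addnC -addSn leq_add2r.
apply: transition_step (transition_persist ll Tp).
by apply: a_pos; rewrite addnA.
Qed.

(** A path without repetition has fewer than [m] edges; waiting at its end makes the horizon [m * B]
    the same for all pairs. *)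
Lemma transition_lower_bound (B : nat) k i j : connectivity a ->
  (forall e, edges_inf a e -> forall k,
     (\bigcup_(l in [set l | (l < B)%N]) edges a (k + l)) e) ->
  eta ^+ (m * B) <= transition_mx k (m * B) i j.
Proof.
move=> aC aB; have /connectP[p0 p0P ->] := aC j i.
case: (shortenP p0P) => p pP pU _.
apply: transition_persist (transition_path k aB pP).
rewrite leq_mul2r; apply/orP; right.
have := max_card [in j :: p]; rewrite card_ord (card_uniqP pU).
exact: ltnW.
Qed.

End Positivity.

Lemma disagreement_sqr_bounded_sums (n : nat) (Y E : nat -> 'M[R]_(m, n))
    (c : nat -> R) : (0 < m)%N ->
  weights_rule a -> connectivity a -> bounded_intercommunication a ->
  (forall k, Y k.+1 = weight_mx k *m Y k + E k) ->
  (forall k, disagreement (E k) <= c k) ->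
  bounded_sums (fun k => c k ^+ 2) ->
  bounded_sums (fun k => disagreement (Y k) ^+ 2).
Proof.
move=> m0 [eta /andP[eta0 eta1] [aD aP]] aC [B B1 aB] YE Ec cS.
have c0 k : 0 <= c k := le_trans (disagreement_ge0 _) (Ec k).
pose T := (m * B)%N; pose d := eta ^+ T.
have Td k i j : d <= transition_mx k T i j.
  exact: (transition_lower_bound (ltW eta0)).
(* A row of the transition matrix has [m] entries, each at least [d], and sums to 1. *)
have md : 0 < m%:R * d <= 1.
  rewrite mulr_gt0 ?ltr0n ?exprn_gt0//=.
  case: (transition_mx_ds 0 T) => _ Tr _.
  rewrite -[leRHS](Tr (Ordinal m0)) mulr_natl.
  rewrite -[X in d *+ X]card_ord -sumr_const.
  exact: ler_sum.
apply: (@bounded_sums_sqr_recursion _ _ (fun k => \sum_(t < T) c (k + t)%N) T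
  (1 - m%:R * d)).
- by move=> k; exact: disagreement_ge0.
- by case/andP: md; lra.
- move=> k; have := disagreement_transition k T YE Ec.
  have := disagreement_contract m0 (Y k) (transition_mx_ds k T) (Td k).
  have := disagreementD (Y (k + T)%N - transition_mx k T *m Y k)
    (transition_mx k T *m Y k).
  by rewrite subrK; lra.
(* A window sum of [c] is a finite sum of shifts of [c], each square summable. *)
- elim: (T) => [|l IH].
    by exists 0 => N; rewrite big1// => k _; rewrite big_ord0 expr0n.
  have := bounded_sums_sqrD IH
    (bounded_sums_shift l (fun k => sqr_ge0 (c k)) cS).
  by apply: bounded_sums_le => k; rewrite big_ord_recr.
Qed.

End Consensus.

(** * Convergence of the iterates *)

Section ProjectedSubgradient.
Context {R : realType} {n m : nat}.
Variables (f : 'I_m -> 'rV[R]_n -> R) (X : set 'rV[R]_n) (L : R).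
Variables (a : 'I_m -> 'I_m -> nat -> R) (alpha : nat -> R).
Variables x v d : 'I_m -> nat -> 'rV[R]_n.
Hypotheses (m_gt0 : (0 < m)%N) (X_closed : closed X) (X_convex : convex_set X).
Hypothesis f_convex : forall i, convex_function [set: 'rV[R]_n] (f i).
Hypothesis L_ge0 : 0 <= L.
Hypothesis subgrad_bounded :
  forall i y s, X y -> subgrad (f i) y s -> enorm s <= L.
Hypotheses (a_weights : weights_rule a) (a_doubly : doubly_stochastic a).
Hypotheses (a_connected : connectivity a).
Hypothesis a_bounded : bounded_intercommunication a.
Hypothesis iterates : projected_subgradient f (fun=> X) a alpha x v d.
Hypothesis alpha_gt0 : forall k, 0 < alpha k.
Hypothesis alpha_sum : series alpha @ \oo --> +oo.
Hypothesis alpha_sqr_sum : bounded_sums (fun k => alpha k ^+ 2).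

Let F y : R := \sum_i f i y.
Let Y k : 'M[R]_(m, n) := \matrix_i x i k.
Let mean k : 'rV[R]_n := \sum_j m%:R^-1 *: x j k.
Let gap k : R := disagreement (Y k).
Let D z k : R := \sum_i dotv (x i k - z) (x i k - z).
Let b k : R := m%:R * L ^+ 2 * alpha k ^+ 2 + 2 * alpha k * L * gap k.

Lemma X_nonempty : X !=set0.
Proof. by case: iterates => x0 _ _ _; exists (x (Ordinal m_gt0) 0%N). Qed.

Lemma iterate_mem i k : X (x i k).
Proof.
case: iterates => x0 _ _ xS; case: k => [|k]; first exact: x0.
by rewrite xS; exact: eproj_mem X_nonempty.
Qed.

Lemma mixed_mem i k : X (v i k).
Proof.
case: iterates => _ -> _ _; case: a_doubly => a0 ar _.
by apply: convex_set_sum => // j; exact: iterate_mem.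
Qed.

Lemma sum_inv_card : \sum_(j < m) m%:R^-1 = 1 :> R.
Proof.
by rewrite sumr_const card_ord -[LHS]mulr_natl divff// pnatr_eq0 -lt0n.
Qed.

Lemma mean_mem k : X (mean k).
Proof.
by apply: convex_set_sum => // [|j]; [exact: sum_inv_card | exact: iterate_mem].
Qed.

Lemma row_avg_mx i k : row i (avg_mx *m Y k) = mean k.
Proof.
rewrite row_mul mulmx_sum_row; apply: eq_bigr => j _.
by rewrite !mxE rowK.
Qed.

Lemma row_weight_mx i k : row i (weight_mx a k *m Y k) = v i k.
Proof.
case: iterates => _ -> _ _.
rewrite row_mul mulmx_sum_row; apply: eq_bigr => j _.
by rewrite !mxE rowK.
Qed.

Lemma enorm_direction i k : enorm (d i k) <= L.
Proof.
by case: iterates => _ _ dP _; exact: subgrad_bounded (mixed_mem i k) (dP i k).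
Qed.

Lemma gap_sqr_bounded_sums : bounded_sums (fun k => gap k ^+ 2).
Proof.
pose E k := Y k.+1 - weight_mx a k *m Y k.
(* The constant: [m] rows, each displaced by at most [2 * alpha k * L], and a factor 2 from rows to
   disagreement. *)
apply: (disagreement_sqr_bounded_sums a_doubly (E := E)
  (c := fun k => 4 * m%:R * L * alpha k)) => // [k|k|].
- by rewrite addrC subrK.
- rewrite (le_trans (disagreement_le m_gt0 _))//.
  suff : rows_norm (E k) <= \sum_(i < m) 2 * (alpha k * L).
    by rewrite sumr_const card_ord -[_ *+ m]mulr_natl; lra.
  apply: ler_sum => i _; rewrite linearB/= row_weight_mx rowK.
  case: iterates => _ _ _ ->.
  rewrite (le_trans (eproj_move_le _ X_closed X_nonempty (mixed_mem i k)))//.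
  rewrite addrAC subrr add0r enormN enormZ gtr0_norm// ler_pM2l//.
  by rewrite ler_wpM2l ?enorm_direction ?ltW.
- apply: bounded_sums_le (bounded_sumsZ (sqr_ge0 (4 * m%:R * L)) alpha_sqr_sum).
  by move=> k; rewrite exprMn.
Qed.

Lemma gap_ge0 k : 0 <= gap k. Proof. exact: disagreement_ge0. Qed.

Lemma b_ge0 k : 0 <= b k.
Proof.
have := gap_ge0 k; have := alpha_gt0 k => /ltW ak gk.
by rewrite addr_ge0 ?mulr_ge0 ?sqr_ge0 ?ler0n.
Qed.

(** The mixed term is handled by [2 * alpha k * gap k <= alpha k ^+ 2 + gap k ^+ 2]. *)
Lemma b_bounded_sums : bounded_sums b.
Proof.
have h := bounded_sumsD
  (bounded_sumsZ (mulr_ge0 (ler0n R m) (sqr_ge0 L)) alpha_sqr_sum)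
  (bounded_sumsZ L_ge0 (bounded_sumsD alpha_sqr_sum gap_sqr_bounded_sums)).
apply: bounded_sums_le h => k; rewrite lerD2l.
have := ler_wpM2l L_ge0 (sqr_ge0 (alpha k - gap k)); nra.
Qed.

Lemma descent z k : X z ->
  D z k.+1 <= D z k + b k - 2 * alpha k * (F (mean k) - F z).
Proof.
move=> Xz; have ak := ltW (alpha_gt0 k).
have Dv : \sum_i dotv (v i k - z) (v i k - z) <= D z k.
  case: a_doubly => a0 ar ac.
  apply: (@le_trans _ _
    (\sum_i \sum_j a i j k * dotv (x j k - z) (x j k - z))).
    apply: ler_sum => i _; case: iterates => _ -> _ _.
    exact: dotv_convex_dist.
  rewrite exchange_big/=; apply: ler_sum => j _.
  by rewrite -mulr_suml ac mul1r.
(* Mixing preserves the mean and does not increase the disagreement. *)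
have gapv : \sum_i enorm (mean k - v i k) <= gap k.
  rewrite /gap (le_trans _ (disagreement_mul _ (weight_mx_ds a_doubly k)))//.
  rewrite /disagreement mulmxA.
  rewrite (const_doubly_stochastic _ (weight_mx_ds a_doubly k)).
  apply: ler_sum => i _.
  by rewrite linearB/= row_weight_mx row_avg_mx enorm_distrC.
(* Expand the step after the nonexpansive projection, apply the subgradient inequality at [v i k],
   then pass from [v i k] to the mean by the Lipschitz bound. *)
have step i : dotv (x i k.+1 - z) (x i k.+1 - z) <= dotv (v i k - z) (v i k - z)
    + 2 * alpha k * (f i z - f i (mean k))
    + 2 * alpha k * L * enorm (mean k - v i k) + L ^+ 2 * alpha k ^+ 2.
  case: iterates => _ _ dP ->.
  rewrite (le_trans (eproj_dist_le _ X_closed X_nonempty X_convex Xz))//.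
  rewrite addrAC; have := dP i k z; have := enorm_direction i k.
  have := subgrad_bounded_lipschitz (v i k) (f_convex i) (@subgrad_bounded i)
    (mean_mem k).
  rewrite -(opprB (v i k) z); move: (v i k - z) => w.
  rewrite !dotvE (dotvC _ (d i k)) -(enorm_sqr (d i k)).
  have := enorm_ge0 (d i k); move: (enorm _) (dotv _ w) => e s e0 H1 eL H2.
  have eL2 : e ^+ 2 <= L ^+ 2 by rewrite ler_sqr ?nnegrE.
  have := ler_wpM2l (sqr_ge0 (alpha k)) eL2; have := ler_wpM2l ak H1.
  have := ler_wpM2l ak H2; nra.
have := ler_sum (index_enum 'I_m) (fun i (_ : true) => step i).
rewrite !big_split/= -/(D z k.+1) -!mulr_sumr sumrB -/(F z) -/(F (mean k)).
rewrite sumr_const card_ord -[_ *+ m]mulr_natl /b.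
have := ler_wpM2l (mulr_ge0 ak L_ge0) gapv.
lra.
Qed.

Lemma descent_sum z k l : X z ->
  D z (k + l) <= D z k + \sum_(t < l) b (k + t)
    - 2 * \sum_(t < l) alpha (k + t)%N * (F (mean (k + t)) - F z).
Proof.
move=> Xz; elim: l => [|l IH].
  by rewrite !big_ord0 addn0 mulr0 subr0 addr0.
rewrite !big_ord_recr/= addnS; have := descent (k + l) Xz; lra.
Qed.

Lemma D_ge0 z k : 0 <= D z k.
Proof. by apply: sumr_ge0 => i _; exact: dotv_ge0. Qed.

Lemma quasi_fejer z k l : argmin_on F X z ->
  D z (k + l) <= D z k + \sum_(t < l) b (k + t).
Proof.
move=> [Xz zmin]; have := descent_sum k l Xz.
suff : 0 <= \sum_(t < l) alpha (k + t)%N * (F (mean (k + t)) - F z) by lra.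
apply: sumr_ge0 => t _; rewrite mulr_ge0 ?subr_ge0 ?(ltW (alpha_gt0 _))//.
exact: zmin (mean_mem _).
Qed.

Lemma frequently_near_optimal z : X z -> forall e, 0 < e -> forall N,
  exists2 k, (N <= k)%N & F (mean k) - F z < e.
Proof.
move=> Xz e e0 N; apply: contrapT => H.
have {}H k : e <= F (mean (N + k)) - F z.
  rewrite leNgt; apply/negP => lt; apply: H.
  by exists (N + k)%N => //; exact: leq_addr.
have [C HC] := b_bounded_sums.
(* If the claim failed, every step from [N] on would cost [2 * e * alpha]; past this threshold the
   total exceeds [D z N + C] by 1, making a squared distance negative. *)
have /cvgryPge/(_ (series alpha N + (D z N + C + 1) / (2 * e))) := alpha_sum.
move=> [K _ /(_ (N + K)%N (leq_addl _ _))/=].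
rewrite /series/= !big_mkord sum_ordD lerD2l ler_pdivrMr ?mulr_gt0// => lt.
have := D_ge0 z (N + K); have := descent_sum N K Xz.
have := HC (N + K)%N; rewrite sum_ordD.
have := sumr_ge0 (index_enum 'I_N) (fun (i : 'I_N) (_ : true) => b_ge0 i).
suff : e * \sum_(t < K) alpha (N + t)%N <=
    \sum_(t < K) alpha (N + t)%N * (F (mean (N + t)) - F z) by lra.
rewrite mulr_sumr; apply: ler_sum => t _.
by rewrite mulrC ler_wpM2l ?(ltW (alpha_gt0 _)).
Qed.

Lemma objective_lipschitz y z : X y -> F y - F z <= m%:R * L * enorm (y - z).
Proof.
move=> Xy; rewrite -sumrB -mulrA mulr_natl -[X in _ *+ X]card_ord -sumr_const.
by apply: ler_sum => i _;
  exact: subgrad_bounded_lipschitz (@subgrad_bounded i) Xy.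
Qed.

Lemma mean_bounded z : argmin_on F X z ->
  exists M, forall k, enorm (mean k) <= M.
Proof.
move=> zmin; have [C HC] := b_bounded_sums.
(* The summand 1 comes from [t <= t ^+ 2 + 1], which avoids a square root. *)
exists (D z 0 + C + 1 + enorm z) => k.
have -> : mean k = (mean k - z) + z by rewrite subrK.
rewrite (le_trans (enormD _ _))// lerD2r.
have DC : D z k <= D z 0 + C.
  have := quasi_fejer 0 k zmin; have := HC k; rewrite add0n.
  by under [X in _ <= _ + X -> _]eq_bigr do rewrite add0n; lra.
have mz : enorm (mean k - z) ^+ 2 <= D z k.
  rewrite enorm_sqr (le_trans (dotv_convex_dist _ _ _ _))//.
    exact: sum_inv_card.
  apply: ler_sum => i _; rewrite ler_piMl ?dotv_ge0// invf_le1 ?ler1n ?ltr0n//.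
have := enorm_ge0 (mean k - z); nra.
Qed.

Lemma optimal_cluster_point : argmin_on F X !=set0 ->
  exists2 p, argmin_on F X p &
    forall e, 0 < e -> forall N, exists2 k, (N <= k)%N & enorm (mean k - p) < e.
Proof.
move=> [z zmin]; have [M HM] := mean_bounded zmin.
(* The times satisfy [k <= l], so a cluster point along them is one of the full sequence of
   means. *)
have near k : exists l, (k <= l)%N /\ F (mean l) - F z < k.+1%:R^-1.
  have [|l kl lF] := frequently_near_optimal zmin.1 (e := k.+1%:R^-1) _ k.
    by rewrite invr_gt0.
  by exists l.
have [s sP] := choice near.
have [p Xp clp] := bounded_seq_cluster X_closed (fun k => mean_mem (s k))
  (fun k => HM (s k)).
exists p; last first.
  move=> e e0 N; have [k Nk kp] := clp e e0 N.
  by exists (s k) => //; exact: leq_trans Nk (sP k).1.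
split => // y Xy; apply: (@le_trans _ _ (F z)); last exact: zmin.2.
apply/ler_addgt0Pr => e e0.
(* Means within [e / 2 / (m * L + 1)] of [p] have objective within [e / 2] of [F p]; the added 1
   keeps the divisor positive. *)
have mL0 : 0 < m%:R * L + 1 by rewrite ltr_wpDl ?mulr_ge0.
have e2 : 0 < e / 2 by rewrite divr_gt0.
have [N _ HN] := near_infty_natSinv_lt (PosNum e2).
have [k Nk kp] := clp _ (divr_gt0 e2 mL0) N.
have kN : k.+1%:R^-1 < e / 2 := HN k Nk.
have := objective_lipschitz (mean (s k)) Xp; rewrite enorm_distrC.
have := enorm_ge0 (mean (s k) - p).
move: kp; rewrite ltr_pdivlMr//; have := (sP k).2; move: kN; move: (k.+1%:R^-1).
by move=> r; lra.
Qed.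

Lemma iterates_converge : argmin_on F X !=set0 ->
  exists2 p, argmin_on F X p &
    forall i, enorm (x i k - p) @[k --> \oo] --> (0 : R).
Proof.
move=> /optimal_cluster_point[p pmin clp]; exists p => // i.
apply/cvgr0Pnorm_lt => e e0.
pose r := e ^+ 2 / 2; have r0 : 0 < r by rewrite divr_gt0 ?exprn_gt0.
(* At a late time near [p], each squared distance is at most [2 * q + 2 * q], so
   [D p k <= 4 * m * q = r / 2]. The tail of [b] adds at most [r / 2], and [r < e ^+ 2]. *)
pose q := r / (8 * m%:R).
have q0 : 0 < q by rewrite divr_gt0 ?mulr_gt0 ?ltr0n.
have [N1 HN1] :=
  bounded_sums_tail b_ge0 b_bounded_sums (divr_gt0 r0 (ltr0n R 2)).
have [N2 HN2] := bounded_sums_tail (fun k => sqr_ge0 (gap k))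
  gap_sqr_bounded_sums q0.
have sq0 : 0 < Num.sqrt q by rewrite sqrtr_gt0.
have [k Nk kp] := clp _ sq0 (maxn N1 N2).
move: Nk; rewrite geq_max => /andP[N1k N2k].
have gk : gap k ^+ 2 <= q.
  by have := HN2 k 1%N N2k; rewrite big_ord1 addn0.
have mk : dotv (mean k - p) (mean k - p) <= q.
  rewrite -enorm_sqr -[leRHS](sqr_sqrtr (ltW q0)).
  by rewrite ler_sqr ?nnegrE ?enorm_ge0// ltW.
have Dk : D p k <= r / 2.
  have -> : r / 2 = \sum_(j < m) (4 * q).
    rewrite sumr_const card_ord -[_ *+ m]mulr_natl /q; field.
    by rewrite pnatr_eq0 -lt0n.
  apply: ler_sum => j _.
  have -> : x j k - p = (x j k - mean k) + (mean k - p) by rewrite addrA subrK.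
  rewrite (le_trans (dotvD_le _ _))// -enorm_sqr.
  suff : enorm (x j k - mean k) ^+ 2 <= gap k ^+ 2 by lra.
  rewrite ler_sqr ?nnegrE ?enorm_ge0 ?gap_ge0//.
  rewrite /gap /disagreement /rows_norm (bigD1 j)//= linearB/= row_avg_mx rowK.
  by rewrite lerDl sumr_ge0// => l _; exact: enorm_ge0.
exists k => // l /= /subnKC <-; rewrite ger0_norm ?enorm_ge0//.
apply: enorm_lt; first exact: ltW.
apply: (@le_lt_trans _ _ (D p (k + (l - k)))).
  by rewrite /D (bigD1 i)//= lerDl sumr_ge0// => j _; exact: dotv_ge0.
apply: (@le_lt_trans _ _ r); last first.
  by rewrite /r ltr_pdivrMr// ltr_pMr ?exprn_gt0// ltr1n.
have := quasi_fejer k (l - k) pmin; have := HN1 k (l - k)%N N1k; lra.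
Qed.

End ProjectedSubgradient.

Theorem proposition4 (R : realType) (n m : nat)
    (f : 'I_m -> 'rV[R]_n -> R)
    (Xs : 'I_m -> set 'rV[R]_n) (X : set 'rV[R]_n) (L : R)
    (a : 'I_m -> 'I_m -> nat -> R) (alpha : nat -> R)
    (x v d : 'I_m -> nat -> 'rV[R]_n)
    (f_convex : forall i, convex_function [set: 'rV[R]_n] (f i))
    (X_closed : closed X) (X_convex : convex_set X)
    (Xs_same : forall i, Xs i = X)
    (L_gt0 : 0 < L)
    (subgrad_bounded : forall i y s, X y -> subgrad (f i) y s -> enorm s <= L)
    (a_weights : weights_rule a)
    (a_doubly : doubly_stochastic a)
    (a_connected : connectivity a)
    (a_bounded : bounded_intercommunication a)
    (iterates : projected_subgradient f Xs a alpha x v d)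
    (alpha_gt0 : forall k, 0 < alpha k)
    (alpha_sum : series alpha @ \oo --> +oo)
    (alpha_sqr_sum : cvgn (series (fun k => alpha k ^+ 2)))
    (opt_nonempty :
      argmin_on (fun y => \sum_(i < m) f i y) (\bigcap_i Xs i) !=set0) :
  exists2 xstar : 'rV[R]_n,
    argmin_on (fun y => \sum_(i < m) f i y) (\bigcap_i Xs i) xstar &
    forall i, enorm (x i k - xstar) @[k --> \oo] --> (0 : R).
Proof.
move: opt_nonempty; rewrite (_ : Xs = fun=> X) in iterates *;
  last exact: funext.
(* Without agents the intersection is the whole space, and any optimal point serves. *)
have [m0|m_gt0] := posnP m.
  by move=> [p pP]; exists p => // i; have := ltn_ord i; rewrite {2}m0.
rewrite (_ : \bigcap__ X = X); last first.
  apply/seteqP; split => y; first by move=> /(_ (Ordinal m_gt0) I).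
  by move=> Xy i _.
(* Partial sums of squares increase, so their limit bounds them. *)
have alpha2 : bounded_sums (fun k => alpha k ^+ 2).
  exists (limn (series (fun k => alpha k ^+ 2))) => N.
  have := nondecreasing_cvgn_le _ alpha_sqr_sum N.
  rewrite /series/= big_mkord; apply.
  by apply/nondecreasing_seqP => k; rewrite !big_mkord big_ord_recr
    lerDl sqr_ge0.
exact: (iterates_converge m_gt0 X_closed X_convex f_convex (ltW L_gt0)
  subgrad_bounded a_weights a_doubly a_connected a_bounded iterates alpha_gt0
  alpha_sum alpha2).
Qed.
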